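(* If $\mathcal{R}$ is a Urysohn monoid and $n\geq 3$ is an integer, then $\mathrm{Th}(\mathcal{U}_{\mathcal{R}})$ is $\mathrm{SOP}_n$ if and only if $\mathrm{arch}(\mathcal{R})\geq n$.
   Context: A distance monoid is a structure $\mathcal{R}=(R,\oplus,\leq,0)$ such that $(R,\oplus,0)$ is a commutative monoid and $\leq$ is a total, translation-invariant order on $R$ with least element $0$. An $\mathcal{R}$-metric space is a set $A$ with a symmetric function $d:A\times A\to R$ such that $d(x,y)=0$ iff $x=y$, and $d(x,z)\leq d(x,y)\oplus d(y,z)$ for all $x,y,z\in A$. For countable $\mathcal{R}$, the $\mathcal{R}$-Urysohn space $\mathcal{U}_{\mathcal{R}}$ is the unique (up to isometry) countable $\mathcal{R}$-metric space that is ultrahomogeneous and contains an isometric copy of every finite $\mathcal{R}$-metric space. It is viewed as a structure in the relational language $\mathcal{L}_R=\{d(x,y)\leq r:r\in R\}$ of binary relations, and $\mathrm{Th}(\mathcal{U}_{\mathcal{R}})$ is its complete $\mathcal{L}_R$-theory. A Urysohn monoid is a countable distance monoid $\mathcal{R}$ such that $\mathrm{Th}(\mathcal{U}_{\mathcal{R}})$ has quantifier elimination in $\mathcal{L}_R$. The archimedean complexity $\mathrm{arch}(\mathcal{R})$ is the minimum $n<\omega$ such that $r_0\oplus r_1\oplus\ldots\oplus r_n=r_1\oplus\ldots\oplus r_n$ for all $r_0\leq r_1\leq\ldots\leq r_n$ in $R$ (an empty sum being $0$); if no such $n$ exists, $\mathrm{arch}(\mathcal{R})=\omega$. For $n\geq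 3$, a complete theory $T$ is $\mathrm{SOP}_n$ (has the $n$-strong order property, in the sense of Shelah) if there are a formula $\varphi(\bar x,\bar y)$, with $\bar x,\bar y$ finite tuples of the same length, and a sequence $(\bar a^l)_{l<\omega}$ in some model of $T$ such that $\varphi(\bar a^k,\bar a^l)$ holds for all $k<l<\omega$, while $\{\varphi(\bar x^1,\bar x^2),\ldots,\varphi(\bar x^{n-1},\bar x^n),\varphi(\bar x^n,\bar x^1)\}$ is inconsistent with $T$. *)

(* Defs.v *)
From HB Require Import structures.
From mathcomp Require Import all_boot all_order.
From mathcomp Require Import boolp classical_sets cardinality.

Set Implicit Arguments.
Unset Strict Implicit.
Unset Printing Implicit Defensive.

Import Order.TTheory.
Local Open Scope classical_set_scope.
Local Open Scope order_scope.

Declare Scope dmonoid_scope.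

(* ** Distance monoids *)

(* The structure is not built on [nmodType] because Hierarchy Builder does not
   allow a new join of additive monoids and orders next to [porderZmodType]. *)
HB.mixin Record isDistanceMonoid (d : Order.disp_t) R & Order.Total d R := {
  dm_zero : R;
  dm_add : R -> R -> R;
  dm_addA : associative dm_add;
  dm_addC : commutative dm_add;
  dm_add0 : left_id dm_zero dm_add;
  dm_leD2r : forall t r s : R, r <= s -> dm_add r t <= dm_add s t;
  dm_le0 : forall r : R, dm_zero <= r
}.

#[short(type="distanceMonoidType")]
HB.structure Definition DistanceMonoid (d : Order.disp_t) :=
  {R of Order.Total d R & isDistanceMonoid d R}.

Notation "0" := dm_zero : dmonoid_scope.
Notation "r ⊕ s" := (dm_add r s) (at level 50, left associativity) : dmonoid_scope.
Local Open Scope dmonoid_scope.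

HB.instance Definition _ (d : Order.disp_t) (R : distanceMonoidType d) :=
  Monoid.isComLaw.Build R dm_zero dm_add (@dm_addA d R) (@dm_addC d R) (@dm_add0 d R).

Definition arch_at (d : Order.disp_t) (R : distanceMonoidType d) (n : nat) : Prop :=
  forall r : nat -> R,
    (forall i, (i < n)%N -> r i <= r i.+1) ->
    \big[dm_add/0]_(0 <= i < n.+1) r i = \big[dm_add/0]_(1 <= i < n.+1) r i.

Definition arch (d : Order.disp_t) (R : distanceMonoidType d) : option nat :=
  match pselect (exists n, `[< arch_at R n >]) with
  | left exn => Some (ex_minn exn)
  | right _ => None
  end.

Definition le_omega (n : nat) (a : option nat) : Prop :=
  if a is Some m then (n <= m)%N else True.

(* ** Generalized metric spaces *)

Record metricSpace (d : Order.disp_t) (R : distanceMonoidType d) := MetricSpace {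
  pt :> Type;
  dist : pt -> pt -> R;
  dist_sym : forall x y, dist x y = dist y x;
  dist_eq0 : forall x y, dist x y = 0 <-> x = y;
  dist_triangle : forall x y z, dist x z <= dist x y ⊕ dist y z
}.

Definition isometric_embedding (d : Order.disp_t) (R : distanceMonoidType d) (A B : metricSpace R)
    (f : A -> B) : Prop :=
  forall x y, dist (f x) (f y) = dist x y.

(* The restriction of [f] to [A] is an arbitrary isometry between finite
   subspaces; the values of [f] outside [A] are irrelevant. *)
Definition ultrahomogeneous (d : Order.disp_t) (R : distanceMonoidType d) (U : metricSpace R) : Prop :=
  forall (A : set U) (f : U -> U), finite_set A ->
    (forall x y, A x -> A y -> dist (f x) (f y) = dist x y) ->
    exists g : U -> U,
      [/\ bijective g, isometric_embedding g & forall x, A x -> g x = f x].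

Record urysohnSpace (d : Order.disp_t) (R : distanceMonoidType d) (U : metricSpace R) : Prop := {
  urysohn_countable : countable [set: U];
  urysohn_homogeneous : ultrahomogeneous U;
  urysohn_universal : forall A : metricSpace R, finite_set [set: A] ->
    exists f : A -> U, isometric_embedding f
}.

(* ** First-order logic with equality over relational languages *)

Record language := Language { symbol :> Type; arity : symbol -> nat }.

(* [formula L n] is the type of formulas with free variables among
   [x_0, ..., x_(n-1)]. [FAll] binds the variable [x_0] of its body and the other
   variables of the body are shifted by one. The remaining connectives and the
   existential quantifier are definable, satisfaction being classical. *)
Inductive formula (L : language) : nat -> Type :=
| FBot n : formula L n
| FEq n (i j : 'I_n) : formula L n
| FRel n (s : L) (v : (arity s).-tuple 'I_n) : formula L n
| FImp n (p q : formula L n) : formula L n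
| FAll n (p : formula L n.+1) : formula L n.

Fixpoint quantifier_free (L : language) (n : nat) (p : formula L n) : bool :=
  match p with
  | FImp _ q r => quantifier_free q && quantifier_free r
  | FAll _ _ => false
  | _ => true
  end.

Record structure (L : language) := Structure {
  dom :> Type;
  interp : forall s : L, (arity s).-tuple dom -> Prop
}.

Fixpoint sat (L : language) (M : structure L) (n : nat) (p : formula L n) :
    n.-tuple M -> Prop :=
  match p with
  | FBot _ => fun _ => False
  | FEq _ i j => fun e => tnth e i = tnth e j
  | FRel _ s v => fun e => interp (map_tuple (tnth e) v)
  | FImp _ q r => fun e => sat q e -> sat r e
  | FAll _ q => fun e => forall x : M, sat q (cons_tuple x e)
  end.

Definition theory (L : language) := formula L 0 -> Prop.

Definition Th (L : language) (M : structure L) : theory L :=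
  fun p => sat p [tuple of [::] : seq M].

Definition models (L : language) (M : structure L) (T : theory L) : Prop :=
  forall p, T p -> Th M p.

Definition quantifier_elimination (L : language) (T : theory L) : Prop :=
  forall n (p : formula L n), exists2 q : formula L n, quantifier_free q &
    forall M : structure L, models M T -> forall e : n.-tuple M, sat p e <-> sat q e.

(* [ordS] is the cyclic successor on ['I_n], so that the last clause says that
   the cycle p(x^1, x^2), ..., p(x^(n-1), x^n), p(x^n, x^1) is not realized in
   any model of [T]. *)
Definition SOP (n : nat) (L : language) (T : theory L) : Prop :=
  exists (m : nat) (p : formula L (m + m)),
    (exists (M : structure L) (a : nat -> m.-tuple M),
       models M T /\
       forall k l, (k < l)%N -> sat p (cat_tuple (a k) (a l))) /\
    ~ (exists (M : structure L) (x : 'I_n -> m.-tuple M),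
         models M T /\
         forall i, sat p (cat_tuple (x i) (x (ordS i)))).

(* ** Metric spaces as first-order structures *)

Definition metric_language (d : Order.disp_t) (R : distanceMonoidType d) : language :=
  @Language R (fun=> 2).

Definition metric_structure (d : Order.disp_t) (R : distanceMonoidType d) (A : metricSpace R) :
    structure (metric_language R) :=
  @Structure (metric_language R) A
    (fun (r : R) (v : 2.-tuple A) => dist (tnth v ord0) (tnth v ord_max) <= r).

(* Main.v *)
Require Import Defs.
From HB Require Import structures.
From mathcomp Require Import all_boot all_order.
From mathcomp Require Import boolp classical_sets cardinality filter.
From mathcomp Require Import zify.

Set Implicit Arguments.
Unset Strict Implicit.
Unset Printing Implicit Defensive.

Import Order.TTheory.
Local Open Scope classical_set_scope.
Local Open Scope order_scope.
Local Open Scope dmonoid_scope.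

(** Why the theorem holds.  Since [arch_at R] is monotone in the number of
    summands, [arch R >= n] means that [arch_at R n.-1] fails.

    Suppose it fails: adding some [r0] below [r1 <= ... <= r_(n-1)] increases the
    sum [r1 ⊕ ... ⊕ r_(n-1)].  Place points in [n] layers, one point of the tuple
    [a^k] in each layer, so that from a point of [a^k] one can step up to the
    next layer of any later [a^l], the [i]-th step at cost [r_i].  The formula
    [climb] says that all these steps from [x] to [y] are possible but that the
    bottom of [y] is farther than [r1 ⊕ ... ⊕ r_(n-1)] from the top of [x].  A
    cycle of [n] tuples is contradictory, because its first [n-1] arrows give a
    path from the bottom of the first tuple to the top of the last one.  An
    infinite chain is not: one cannot climb all layers while going back in the
    chain, and [layered_dist], which charges an additional [r0] for joining two
    layers against the order of the chain, is a pseudometric.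

    Suppose now that [arch_at R n.-1] holds and that a formula has an infinite
    chain in a model [M].  By quantifier elimination the formula depends on
    finitely many comparisons [d(x, y) <= r], and by Ramsey's theorem these are
    the same for all pairs of the chain.  It remains to close up the chain, that
    is, to find tuples [x^k] of [U], for [k] in [Z/n], such that [x^k] and
    [x^(k+1)] satisfy exactly the comparisons of an increasing pair of the chain.
    Weigh each pair of points of consecutive tuples by the least radius that it
    has to respect, and take the shortest path metric.  Distances are then small
    enough; the point is that no path is too cheap.  A path in the cycle lifts to
    the chain.  If it does not wind around [Z/n], the lift ends where it should,
    and the triangle inequality in [M] bounds its cost from below
    ([walk_lift]).  If it winds, the lift may end in the wrong tuple; going once
    more back and forth along one of its arrows, of cost [f], repairs this
    ([walk_lift_zigzag]).  But a winding path has at least [n-1] arrows, so for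
    the cheapest one [f ⊕ f] is absorbed by the other arrows, and the bound is the
    same ([walk_long]).  Finite pseudometric spaces embed in [U], which gives the
    cycle ([closed_chain_realized]). *)

(** * Choice and Ramsey's theorem *)

(** Dependent choice in the form used below: each term is chosen from the whole
    list of its predecessors, not only from the last one. *)
Lemma prefix_choice (T : Type) (Q : seq T -> Prop) :
  Q [::] -> (forall s, Q s -> exists y, Q (rcons s y)) ->
  exists u : nat -> T, forall k, Q (mkseq u k).
Proof.
move=> Q0 Qext.
have ext s : {y | Q s -> Q (rcons s y)}.
  apply: cid; have [y0 _] := Qext _ Q0.
  have [/Qext[y Qy]|nQ] := pselect (Q s); first by exists y.
  by exists y0.
pose pre := fix pre k := if k is k'.+1 then rcons (pre k') (sval (ext (pre k'))) else [::].
exists (fun k => sval (ext (pre k))) => k.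
suff -> : mkseq (fun k => sval (ext (pre k))) k = pre k.
  by elim: k => //= k IHk; apply: (svalP (ext _)).
elim: k => //= k IHk.
by rewrite -[LHS]/(map _ (iota 0 k.+1)) -addn1 iotaD map_cat -/(mkseq _ k) IHk cats1.
Qed.

(** A nonprincipal ultrafilter [G] decides, for each [k], whether [P k l] holds
    for most [l], and then which answer is the right one for most [k].  A
    homogeneous sequence is built greedily: a finite list of indices with the
    majority answer leaves most numbers admissible as next term. *)
Lemma ramsey_pairs (P : nat -> nat -> Prop) :
  exists2 g : nat -> nat, {homo g : k l / (k < l)%N} &
    (forall k l, (k < l)%N -> P (g k) (g l)) \/
    (forall k l, (k < l)%N -> ~ P (g k) (g l)).
Proof.
have [G [GU subG]] := @ultraFilterLemma nat \oo _.
have extract (P' : nat -> nat -> Prop) (A : set nat) :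
    G A -> (forall k, A k -> G (P' k)) ->
    exists2 g : nat -> nat, {homo g : k l / (k < l)%N} &
      forall k l, (k < l)%N -> P' (g k) (g l).
  move=> GA AP.
  pose good s := (forall x, x \in s -> A x) /\
    sorted ltn s /\ pairwise (fun x y => `[< P' x y >]) s.
  have [|s [sA [sS sP]]|u uP] := @prefix_choice nat good; first by [].
    have : G [set y | A y /\ forall x, x \in s -> (x < y)%N /\ P' x y].
      apply: filterI => //.
      elim: s sA {sS sP} => [_|x s IHs sA]; first by apply: filterS filterT.
      have Ax : A x by apply: sA; rewrite mem_head.
      have {IHs} IHs : G [set y | forall x0, x0 \in s -> (x0 < y)%N /\ P' x0 y].
        by apply: IHs => z zs; apply: sA; rewrite inE zs orbT.
      have Gx : G [set y | (x < y)%N] by apply: subG; exists x.+1.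
      apply: filterS (filterI (filterI Gx (AP x Ax)) IHs) => y [[xy Pxy] H] z.
      by rewrite inE => /predU1P[->//|/H].
    move=> /filter_ex[y [Ay Hy]]; exists y; split.
      by move=> x; rewrite mem_rcons inE => /predU1P[->//|/sA].
    rewrite -cats1 pairwise_cat sP /= andbT allrel1r; split; last first.
      by apply/allP => x /Hy[_ ?]; apply/asboolP.
    rewrite sorted_pairwise ?pairwise_cat; last exact: ltn_trans.
    rewrite /= andbT -sorted_pairwise ?sS; last exact: ltn_trans.
    by rewrite andbT allrel1r; apply/allP => x /Hy[].
  exists u => k l kl; have [_ [uS uQ]] := uP l.+1.
    move: uS; rewrite sorted_pairwise; last exact: ltn_trans.
    move=> /(pairwiseP 0%N) /(_ k l); rewrite !inE size_mkseq !nth_mkseq ?leqnn ?ltnS 1?ltnW //.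
    exact.
  move: uQ => /(pairwiseP 0%N) /(_ k l); rewrite !inE size_mkseq !nth_mkseq ?leqnn ?ltnS 1?ltnW //.
  exact.
have [GA|GA] := in_ultra_setVsetC [set k | G (P k)] GU.
  by have [g gi gP] := extract P _ GA (fun k => id); exists g => //; left.
have [|g gi gP] := extract (fun k l => ~ P k l) _ GA; last by exists g => //; right.
by move=> k /= nGP; have [//|] := in_ultra_setVsetC (P k) GU.
Qed.

Lemma ramsey_pairs_family (I : eqType) (s : seq I) (P : I -> nat -> nat -> Prop) :
  exists2 g : nat -> nat, {homo g : k l / (k < l)%N} &
    forall i, i \in s ->
      (forall k l, (k < l)%N -> P i (g k) (g l)) \/
      (forall k l, (k < l)%N -> ~ P i (g k) (g l)).
Proof.
elim: s => [|i s [g g_inc gP]]; first by exists id.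
have [h h_inc hP] := ramsey_pairs (fun k l => P i (g k) (g l)).
exists (g \o h) => [k l /h_inc/g_inc//|j]; rewrite inE => /predU1P[->//|/gP].
by case=> H; [left|right] => k l /h_inc; apply: H.
Qed.

(** * Distance monoids *)

Section DistanceMonoid.
Variables (d : Order.disp_t) (R : distanceMonoidType d).
Implicit Types (r : R).

Lemma dm_addr0 r : r ⊕ 0 = r.
Proof. by rewrite dm_addC dm_add0. Qed.

Lemma dm_leD r r' s s' : r <= r' -> s <= s' -> r ⊕ s <= r' ⊕ s'.
Proof.
move=> rr' ss'; apply: le_trans (dm_leD2r _ _ _ rr') _.
by rewrite ![r' ⊕ _]dm_addC; apply: dm_leD2r.
Qed.

Lemma dm_leDl r s : r <= s ⊕ r.
Proof. by rewrite -{1}(dm_add0 r); apply: dm_leD2r; apply: dm_le0. Qed.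

Lemma dm_leDr r s : r <= r ⊕ s.
Proof. by rewrite dm_addC; apply: dm_leDl. Qed.

Lemma dm_le0_eq r : r <= 0 -> r = 0.
Proof. by move=> r_le0; apply/le_anti; rewrite r_le0 dm_le0. Qed.

(** [arch_at R N] speaks of increasing sequences of exactly [N.+1] terms.  As
    addition is commutative, it applies to any [N] terms of [x] after sorting
    them, and the remaining terms do no harm. *)
Lemma absorb_min N r x :
  arch_at R N -> (N <= size x)%N -> {in x, forall s, r <= s} ->
  r ⊕ \big[dm_add/0]_(s <- x) s = \big[dm_add/0]_(s <- x) s.
Proof.
move=> archN Nx r_le; rewrite -(cat_take_drop N x) big_cat dm_addA.
have {Nx} : size (take N x) = N by rewrite size_takel.
have {r_le} : {in take N x, forall s, r <= s} by move=> s /mem_take; apply: r_le.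
move: (take N x) => y r_le sz_y; congr (_ ⊕ _).
rewrite -(perm_big _ (introT permPl (perm_sort <=%O y))) /=.
have : sorted <=%O (r :: sort <=%O y).
  rewrite /= path_sortedE; last exact: le_trans.
  rewrite sort_le_sorted andbT; apply/allP => s.
  by rewrite mem_sort; apply: r_le.
have: size (sort <=%O y) = N by rewrite size_sort.
move: (sort _ y) => z sz_z /sortedP-/(_ r) z_sorted.
have := archN (nth r (r :: z)).
rewrite big_nat_recl //= big_add1 /= -sz_z -!(big_nth _ predT id) => -> //.
Qed.

Lemma arch_at_leq m n : (m <= n)%N -> arch_at R m -> arch_at R n.
Proof.
move=> mn archm r r_mono.
have := @absorb_min m (r 0%N) [seq r i | i <- index_iota 1 n.+1] archm.
rewrite !big_map size_map size_iota subn1 => absorb.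
rewrite big_ltn // absorb // => _ /mapP[i + ->].
rewrite mem_index_iota => /andP[_]; elim: i => // i IHi i_lt.
by apply: le_trans (IHi (ltnW i_lt)) (r_mono _ _).
Qed.

Lemma le_omega_arch n : le_omega n.+1 (arch R) <-> ~ arch_at R n.
Proof.
rewrite /arch; case: pselect => [ex|nex] /=; last first.
  by split=> // _ archn; apply: nex; exists n; apply/asboolP.
case: ex_minnP => m /asboolP archm m_min; split=> [nm archn|narchn].
  by have := m_min n (introT (asboolP _) archn); rewrite leqNgt nm.
by rewrite ltnNge; apply/negP => mn; apply: narchn; apply: arch_at_leq archm.
Qed.

Definition pseudometric (T : Type) (D : T -> T -> R) :=
  [/\ forall x, D x x = 0, forall x y, D x y = D y x &
      forall x y z, D x z <= D x y ⊕ D y z].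

(** ** Shortest paths *)

Section ShortestPaths.
Variables (T : finType) (w : T -> T -> R).
Hypotheses (w_sym : forall x y, w x y = w y x) (w_refl : forall x, w x x = 0).

(** The shortest path metric of a finite weighted graph, by recursion on the
    vertices that a path may pass through.  In this form the minimum is over
    finitely many values by construction, and the triangle inequality does not
    require removing loops from paths. *)
Fixpoint floyd_warshall (s : seq T) (x y : T) : R :=
  if s is v :: s' then
    Order.min (floyd_warshall s' x y)
              (floyd_warshall s' x v ⊕ floyd_warshall s' v y)
  else w x y.

Lemma floyd_warshall_sym s x y : floyd_warshall s x y = floyd_warshall s y x.
Proof.
elim: s x y => //= v s IHs x y.
by rewrite IHs dm_addC [floyd_warshall s x v]IHs [floyd_warshall s v y]IHs.
Qed.

Lemma floyd_warshall_le s x y : floyd_warshall s x y <= w x y.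
Proof. by elim: s x y => //= v s IHs x y; rewrite ge_min IHs. Qed.

Lemma floyd_warshall_refl s x : floyd_warshall s x x = 0.
Proof. by apply: dm_le0_eq; rewrite -(w_refl x); apply: floyd_warshall_le. Qed.

Lemma floyd_warshall_triangle s x v y : v \in s ->
  floyd_warshall s x y <= floyd_warshall s x v ⊕ floyd_warshall s v y.
Proof.
elim: s x v y => //= u s IHs x v y.
rewrite inE => /predU1P[->|vs].
  rewrite !floyd_warshall_refl dm_add0 dm_addr0 !minxx.
  by rewrite ge_min lexx orbT.
rewrite ge_min /Order.min.
case: ifP => _; case: ifP => _; apply/orP.
- by left; apply: IHs.
- by right; rewrite dm_addA; apply: dm_leD2r; apply: IHs.
- by right; rewrite -dm_addA; apply: dm_leD => //; apply: IHs.
- right; rewrite -dm_addA; apply: dm_leD => //.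
  by rewrite dm_addA; apply: dm_leDl.
Qed.

Lemma floyd_warshall_pseudometric : pseudometric (floyd_warshall (enum T)).
Proof.
split=> [x|x y|x y z]; [exact: floyd_warshall_refl|exact: floyd_warshall_sym|].
by apply: floyd_warshall_triangle; rewrite mem_enum.
Qed.

(** The value of [floyd_warshall] is the cost of some path: whatever holds for
    single edges and is stable under concatenation holds for it. *)
Lemma floyd_warshall_ind (P : T -> T -> R -> Prop) s :
  (forall x y, P x y (w x y)) ->
  (forall x y z r r', P x y r -> P y z r' -> P x z (r ⊕ r')) ->
  forall x y, P x y (floyd_warshall s x y).
Proof.
move=> Pw Pcat; elim: s => //= v s IHs x y.
by rewrite /Order.min; case: ifP => _ //; apply: Pcat (IHs _ _) (IHs _ _).
Qed.

End ShortestPaths.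
End DistanceMonoid.

(** * Embeddings into the Urysohn space *)

Section Embeddings.
Variables (d : Order.disp_t) (R : distanceMonoidType d) (U : metricSpace R).
Hypothesis U_urysohn : urysohnSpace U.

(** The space [A] consists of the chosen representatives of the classes of points
    at distance zero; universality of [U] applies to it. *)
Lemma finite_pseudometric_embedding (T : finType) (D : T -> T -> R) :
  pseudometric D -> exists f : T -> U, forall x y, dist (f x) (f y) = D x y.
Proof.
case=> D0 Dsym Dtri.
pose rep x := odflt x [pick y | D x y == 0].
have Drep x : D x (rep x) = 0 by rewrite /rep; case: pickP => [y /eqP|].
have D_eq x x' y : D x x' = 0 -> D x y = D x' y.
  move=> xx'; apply/le_anti/andP; split.
    by rewrite -[D x' y]dm_add0 -xx'.
  by rewrite -[D x y]dm_add0 -xx' [D x x']Dsym.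
have rep_eq x x' : D x x' = 0 -> rep x = rep x'.
  move=> xx'; rewrite /rep.
  under eq_pick => y do rewrite (D_eq _ _ _ xx').
  by case: pickP => // /(_ x'); rewrite D0 eqxx.
have rep_idem x : rep (rep x) == rep x by rewrite -(rep_eq x (rep x)).
pose D' (x y : {x : T | rep x == x}) := D (val x) (val y).
have D'_eq0 x y : D' x y = 0 <-> x = y.
  split=> [/rep_eq xy|->]; last exact: D0.
  by apply: val_inj; rewrite /= -(eqP (valP x)) xy (eqP (valP y)).
pose A := MetricSpace (fun x y => Dsym (val x) (val y)) D'_eq0
  (fun x y z => Dtri (val x) (val y) (val z)).
have [|f f_iso] := urysohn_universal U_urysohn (A := A).
  exact: (@finite_finset {x : T | rep x == x}).
exists (fun x => f (exist _ (rep x) (rep_idem x))) => x y.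
rewrite f_iso /= -(D_eq x) // Dsym -(D_eq y) //; exact: Dsym.
Qed.

(** One point at a time: the first [k.+1] points embed by universality, and by
    homogeneity an automorphism carries the first [k] of them to the points that
    are already placed. *)
Lemma sequence_pseudometric_embedding (D : nat -> nat -> R) :
  pseudometric D -> exists u : nat -> U, forall i j, dist (u i) (u j) = D i j.
Proof.
case=> D0 Dsym Dtri.
pose good (s : seq U) := forall u0 i j, (i < size s)%N -> (j < size s)%N ->
  dist (nth u0 s i) (nth u0 s j) = D i j.
have [//||u uP] := @prefix_choice U good; last first.
  exists u => i j; have := uP (maxn i j).+1 (u 0%N) i j.
  by rewrite size_mkseq !nth_mkseq ?ltnS ?leq_maxl ?leq_maxr //; apply.
move=> s s_iso; set k := size s.
have [|f f_iso] := @finite_pseudometric_embedding 'I_k.+1 (fun i j => D i j).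
  by split=> [i|i j|i j l]; [apply: D0|apply: Dsym|apply: Dtri].
pose u0 := f ord0.
pose A : set U := f @` [set i : 'I_k.+1 | (i < k)%N].
(* The points [f i] need not be distinct, so an index is chosen for each point. *)
pose move_back (y : U) : U := nth u0 s (xget ord_max [set i : 'I_k.+1 | (i < k)%N /\ f i = y]).
have move_backP y : A y -> exists i : 'I_k.+1, [/\ (i < k)%N, f i = y & move_back y = nth u0 s i].
  case=> i /= ik fi; rewrite /move_back; case: xgetP => [j _ [jk fj]|]; first by exists j.
  by move=> /(_ i) [].
have [||g [_ g_iso g_ext]] := urysohn_homogeneous U_urysohn (A := A) (f := move_back).
- by apply: finite_image; apply: finite_finset.
- move=> x y /move_backP[i [ik <- ->]] /move_backP[j [jk <- ->]].
  by rewrite s_iso.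
exists (g (f ord_max)) => v0.
have new i : (i < k)%N -> dist (nth v0 s i) (g (f ord_max)) = D i k.
  move=> ik; pose i' : 'I_k.+1 := Ordinal (ltnW ik : (i < k.+1)%N).
  have Ai' : A (f i') by exists i'.
  have [j [jk fji gfi]] := move_backP _ Ai'.
  (* [f i'] is moved to the [j]-th point of [s], which is also the [i]-th one:
     as [f j = f i'], these points are at distance [D i i = 0]. *)
  have <- : g (f i') = nth v0 s i.
    rewrite g_ext // gfi (set_nth_default v0) //; apply/dist_eq0.
    by rewrite s_iso // -(D0 i) -[D i i](f_iso i' i') -{1}fji f_iso.
  by rewrite g_iso f_iso.
move=> i j; rewrite size_rcons !ltnS !nth_rcons -/k.
case: (ltngtP i k) => // [ik|->] _; case: (ltngtP j k) => // [jk|->] _.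
- exact: s_iso.
- exact: new.
- by rewrite dist_sym Dsym; apply: new.
- by rewrite D0; apply/dist_eq0.
Qed.

End Embeddings.

(** * First-order properties of models *)

Fixpoint universal_closure (L : language) n : formula L n -> formula L 0 :=
  if n is n'.+1 then fun p => universal_closure (FAll p) else id.

(** Universal facts about [U] pass to all models of its theory through this
    sentence; it is applied below to the axioms of metric spaces. *)
Lemma Th_universal_closure (L : language) (M : structure L) n (p : formula L n) :
  Th M (universal_closure p) <-> forall e : n.-tuple M, sat p e.
Proof.
elim: n p => [|n IHn] p.
  split=> [Mp e|]; last exact.
  by rewrite (tuple0 e).
rewrite [X in X <-> _](IHn (FAll p)); split=> [Mp e|Mp e x]; last exact: Mp.
by rewrite (tuple_eta e); apply: (Mp (behead_tuple e)).
Qed.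

Section MetricTheory.
Variables (d : Order.disp_t) (R : distanceMonoidType d).
Implicit Types M : structure (metric_language R).

Definition dist_at_most n (r : R) (i j : 'I_n) : formula (metric_language R) n :=
  @FRel (metric_language R) n r [tuple i; j].

(** The atomic relation of an abstract model [M], where distances need not exist
    as elements of [R]. *)
Definition le_dist M (r : R) (x y : M) : Prop :=
  @interp (metric_language R) M r [tuple x; y].

Lemma sat_dist_at_most M n r (i j : 'I_n) (e : n.-tuple M) :
  sat (dist_at_most r i j) e = le_dist r (tnth e i) (tnth e j).
Proof. by congr (interp _); apply: val_inj. Qed.

Lemma le_distE (U : metricSpace R) r (x y : U) :
  @le_dist (metric_structure U) r x y = (dist x y <= r).
Proof. by []. Qed.

Lemma sat_imp M n (p q : formula (metric_language R) n) (e : n.-tuple M) :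
  sat (FImp p q) e = (sat p e -> sat q e).
Proof. by []. Qed.

Fixpoint radii n (p : formula (metric_language R) n) : seq R :=
  match p with
  | FRel _ r _ => [:: r]
  | FImp _ q q' => radii q ++ radii q'
  | FAll _ q => radii q
  | _ => [::]
  end.

(** This reduces the type of a tuple, as far as [p] can see it, to finitely many
    comparisons, so that Ramsey's theorem applies. *)
Lemma sat_quantifier_free M M' n (p : formula (metric_language R) n)
    (e : n.-tuple M) (e' : n.-tuple M') :
  quantifier_free p ->
  (forall i j, tnth e i = tnth e j <-> tnth e' i = tnth e' j) ->
  (forall r i j, r \in radii p ->
     le_dist r (tnth e i) (tnth e j) <-> le_dist r (tnth e' i) (tnth e' j)) ->
  sat p e <-> sat p e'.
Proof.
elim: p e e' => //= {}n.
- move=> r v e e' _ _ eR.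
  have vE (A : Type) (t : n.-tuple A) :
      map_tuple (tnth t) v = [tuple tnth t (tnth v ord0); tnth t (tnth v ord_max)].
    apply: eq_from_tnth => i; rewrite tnth_map.
    by have [->|->] : i = ord0 \/ i = ord_max
      by case: i => [[|[|//]] lt_i]; [left|right]; apply: val_inj.
  by rewrite !vE; apply: eR; rewrite mem_head.
- move=> p IHp q IHq e e' /andP[qfp qfq] eE eR.
  rewrite (IHp e e') ?(IHq e e') //.
    by move=> r i j rq; apply: eR; rewrite mem_cat rq orbT.
  by move=> r i j rp; apply: eR; rewrite mem_cat rp.
Qed.

Section Models.
Variables (U : metricSpace R) (M : structure (metric_language R)).
Hypothesis M_models : models M (Th (metric_structure U)).

Lemma transfer n (p : formula (metric_language R) n) :
  (forall e : n.-tuple (metric_structure U), sat p e) -> forall e : n.-tuple M, sat p e.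
Proof.
by move=> Up; apply/Th_universal_closure/M_models/Th_universal_closure.
Qed.

Lemma le_dist_sym r (x y : M) : le_dist r x y -> le_dist r y x.
Proof.
have := @transfer 2 (FImp (dist_at_most r ord0 ord_max) (dist_at_most r ord_max ord0)).
move=> /(_ _ [tuple x; y]); rewrite ?sat_imp !sat_dist_at_most; apply=> e.
by rewrite ?sat_imp !sat_dist_at_most !le_distE dist_sym.
Qed.

Lemma le_dist_mono r s (x y : M) : r <= s -> le_dist r x y -> le_dist s x y.
Proof.
move=> rs.
have := @transfer 2 (FImp (dist_at_most r ord0 ord_max) (dist_at_most s ord0 ord_max)).
move=> /(_ _ [tuple x; y]); rewrite ?sat_imp !sat_dist_at_most; apply=> e.
by rewrite ?sat_imp !sat_dist_at_most !le_distE => /le_trans; apply.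
Qed.

Lemma le_dist_triangle r s (x y z : M) :
  le_dist r x y -> le_dist s y z -> le_dist (r ⊕ s) x z.
Proof.
pose i1 : 'I_3 := Ordinal (isT : (1 < 3)%N).
have := @transfer 3 (FImp (dist_at_most r ord0 i1) (FImp (dist_at_most s i1 ord_max)
  (dist_at_most (r ⊕ s) ord0 ord_max))).
move=> /(_ _ [tuple x; y; z]); rewrite ?sat_imp !sat_dist_at_most; apply=> e.
rewrite ?sat_imp !sat_dist_at_most !le_distE => xy yz.
by apply: le_trans (dist_triangle _ _ _) (dm_leD xy yz).
Qed.

Lemma le_dist0 (x y : M) : le_dist 0 x y <-> x = y.
Proof.
split.
  have := @transfer 2 (FImp (dist_at_most 0 ord0 ord_max) (FEq _ ord0 ord_max)).
  move=> /(_ _ [tuple x; y]); rewrite ?sat_imp !sat_dist_at_most; apply=> e.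
  by rewrite ?sat_imp !sat_dist_at_most !le_distE => /dm_le0_eq/dist_eq0.
have := @transfer 2 (FImp (FEq _ ord0 ord_max) (dist_at_most 0 ord0 ord_max)).
move=> /(_ _ [tuple x; y]); rewrite ?sat_imp !sat_dist_at_most; apply=> e.
by rewrite ?sat_imp !sat_dist_at_most !le_distE => /dist_eq0 ->.
Qed.

Lemma le_dist_bounded r : (forall x y : U, dist x y <= r) -> forall x y : M, le_dist r x y.
Proof.
move=> Ur x y; have := @transfer 2 (dist_at_most r ord0 ord_max).
by move=> /(_ _ [tuple x; y]); rewrite !sat_dist_at_most; apply=> e; rewrite sat_dist_at_most; apply: Ur.
Qed.

End Models.
End MetricTheory.

(** * A strong order from a non-absorbing sum *)

Section LayeredPseudometric.
Variables (d : Order.disp_t) (R : distanceMonoidType d).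
Variables (r0 : R) (rho : nat -> R).
Hypothesis r0_le : forall i, r0 <= rho i.

Definition layer_gap (i j : nat) : R := \big[dm_add/0]_(i <= t < j) rho t.

Definition penalty (k l : nat) : R := if (k < l)%N then 0 else r0.

(** The point [(k, i)] is the entry in layer [i] of the [k]-th tuple of the chain.
    Two layers are joined at cost [layer_gap], provided that the upper point is
    later in the chain; otherwise [r0] has to be paid as well. *)
Definition layered_dist (x y : nat * nat) : R :=
  if (x.2 < y.2)%N then layer_gap x.2 y.2 ⊕ penalty x.1 y.1
  else if (y.2 < x.2)%N then layer_gap y.2 x.2 ⊕ penalty y.1 x.1
  else if x.1 == y.1 then 0 else r0.

Lemma layer_gap_cat i j h : (i <= j)%N -> (j <= h)%N ->
  layer_gap i h = layer_gap i j ⊕ layer_gap j h.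
Proof. by move=> ij jh; rewrite /layer_gap (big_cat_nat ij jh). Qed.

Lemma le_layer_gap i j : (i < j)%N -> r0 <= layer_gap i j.
Proof.
by move=> ij; rewrite /layer_gap big_ltn //; apply: le_trans (r0_le i) (dm_leDr _ _).
Qed.

Lemma penalty_le k l : penalty k l <= r0.
Proof. by rewrite /penalty; case: ifP => // _; apply: dm_le0. Qed.

Lemma penalty_triangle k l m : penalty k m <= penalty k l ⊕ penalty l m.
Proof.
rewrite {1}/penalty; case: ltnP => [_|mk]; first exact: dm_le0.
rewrite /penalty; case: (ltnP k l) => [kl|_]; last exact: dm_leDr.
by rewrite ltnNge ltnW ?(leq_ltn_trans mk kl) //= dm_leDl.
Qed.

Lemma layered_dist_sym x y : layered_dist x y = layered_dist y x.
Proof.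
by rewrite /layered_dist; case: (ltngtP x.2 y.2) => //= _; rewrite eq_sym.
Qed.

Lemma layered_distE k i l j : (i < j)%N ->
  layered_dist (k, i) (l, j) = layer_gap i j ⊕ penalty k l.
Proof. by rewrite /layered_dist /= => ->. Qed.

Lemma layered_distE_sym k i l j : (j < i)%N ->
  layered_dist (k, i) (l, j) = layer_gap j i ⊕ penalty l k.
Proof. by move=> ji; rewrite layered_dist_sym layered_distE. Qed.

Lemma layered_dist_same k l i : layered_dist (k, i) (l, i) = if k == l then 0 else r0.
Proof. by rewrite /layered_dist /= ltnn. Qed.

(** A direct connection costs at most [r0] in excess of its [layer_gap].  A detour
    through a layer that is not between the two endpoints costs at least [r0] more
    than this gap; so does a detour inside one of the two end layers.  A detour
    through a layer strictly between them goes against the order of the chain at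
    least once if the direct connection does ([penalty_triangle]). *)
Lemma layered_pseudometric : pseudometric layered_dist.
Proof.
(* By symmetry, [x] is not above [z]. *)
have D_le x y z : (x.2 <= z.2)%N ->
    layered_dist x z <= layered_dist x y ⊕ layered_dist y z.
  case: x y z => [k i] [m h] [l j] /=; rewrite leq_eqVlt => /predU1P[<-{j}|ij].
    have same_le : layered_dist (k, i) (l, i) <= r0.
      by rewrite layered_dist_same; case: ifP => // _; apply: dm_le0.
    case: (ltngtP h i) => [hi|ih|->]; first 2 last.
    - rewrite !layered_dist_same; case: (eqVneq k m) => [->|_]; last first.
        by case: ifP => _; [apply: dm_le0|apply: dm_leDr].
      by rewrite dm_add0.
    - apply: le_trans same_le (le_trans _ (dm_leDl _ _)).
      by rewrite layered_distE //; apply: le_trans (le_layer_gap hi) (dm_leDr _ _).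
    - apply: le_trans same_le (le_trans _ (dm_leDr _ _)).
      by rewrite layered_distE //; apply: le_trans (le_layer_gap ih) (dm_leDr _ _).
  rewrite layered_distE //; case: (ltngtP h i) => [hi|ih|->].
  - rewrite layered_distE_sym // layered_distE ?(ltn_trans hi) //.
    rewrite (layer_gap_cat (ltnW hi) (ltnW ij)) dm_addC; apply: dm_leD.
      exact: le_trans (penalty_le _ _) (le_trans (le_layer_gap hi) (dm_leDr _ _)).
    exact: le_trans (dm_leDl _ _) (dm_leDr _ _).
  - rewrite layered_distE //; case: (ltngtP h j) => [hj|jh|->].
    + rewrite layered_distE // (layer_gap_cat (ltnW ih) (ltnW hj)).
      by rewrite [leRHS]Monoid.mulmACA; apply: dm_leD => //; apply: penalty_triangle.
    + rewrite layered_distE_sym // (layer_gap_cat (ltnW ij) (ltnW jh)).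
      rewrite -!dm_addA; apply: dm_leD => //.
      exact: le_trans (penalty_le _ _) (le_trans (le_layer_gap jh) (dm_leDr _ _)).
    + rewrite layered_dist_same; case: eqP => [->|_]; first by rewrite dm_addr0.
      exact: dm_leD (dm_leDr _ _) (penalty_le _ _).
  - rewrite layered_dist_same layered_distE //; case: eqP => [->|_].
      by rewrite dm_add0.
    by rewrite dm_addC; apply: dm_leD (penalty_le _ _) (dm_leDr _ _).
split=> [[k i]|x y|x y z]; last 2 first.
- exact: layered_dist_sym.
- have [/D_le//|/ltnW zx] := leqP x.2 z.2.
  rewrite layered_dist_sym dm_addC [layered_dist x y]layered_dist_sym.
  by rewrite [layered_dist y z]layered_dist_sym; apply: D_le.
- by rewrite layered_dist_same eqxx.
Qed.

End LayeredPseudometric.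

Section StrongOrderFormula.
Variables (d : Order.disp_t) (R : distanceMonoidType d) (rho : nat -> R) (p : nat).

Definition ascent (i : 'I_p) : formula (metric_language R) (p.+1 + p.+1) :=
  dist_at_most (rho i) (lshift p.+1 (widen_ord (leqnSn p) i)) (rshift p.+1 (lift ord0 i)).

Definition climb_bound : formula (metric_language R) (p.+1 + p.+1) :=
  dist_at_most (layer_gap rho 0 p) (rshift p.+1 ord0) (lshift p.+1 ord_max).

(** The conjunction of all [ascent i] and of the negation of [climb_bound], in
    terms of the implication and falsity. *)
Definition climb : formula (metric_language R) (p.+1 + p.+1) :=
  FImp (foldr (fun i => FImp (ascent i)) climb_bound (enum 'I_p)) (FBot _ _).

Lemma sat_climb (M : structure (metric_language R)) (a b : p.+1.-tuple M) :
  sat climb (cat_tuple a b) <->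
  (forall i : 'I_p, le_dist (rho i) (tnth a (widen_ord (leqnSn p) i)) (tnth b (lift ord0 i))) /\
  ~ le_dist (layer_gap rho 0 p) (tnth b ord0) (tnth a ord_max).
Proof.
have ascentE i : sat (ascent i) (cat_tuple a b) =
    le_dist (rho i) (tnth a (widen_ord (leqnSn p) i)) (tnth b (lift ord0 i)).
  by rewrite sat_dist_at_most tnth_lshift tnth_rshift.
have boundE : sat climb_bound (cat_tuple a b) =
    le_dist (layer_gap rho 0 p) (tnth b ord0) (tnth a ord_max).
  by rewrite sat_dist_at_most tnth_lshift tnth_rshift.
have foldE s : sat (foldr (fun i => FImp (ascent i)) climb_bound s) (cat_tuple a b) <->
    ((forall i, i \in s -> sat (ascent i) (cat_tuple a b)) ->
     sat climb_bound (cat_tuple a b)).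
  elim: s => [|i s IHs]; first by split=> [//|]; apply.
  rewrite [foldr _ _ _]/= sat_imp IHs; split=> [H Hs|H Hi Hs].
    by apply: H => [|j js]; apply: Hs; rewrite inE ?eqxx ?js ?orbT.
  by apply: H => j; rewrite inE => /predU1P[->//|/Hs].
rewrite sat_imp foldE boundE; split=> [nH|[asc nbound] H].
  split=> [i|bound]; last by apply: nH.
  apply: contrapT => nasc; apply: nH => asc; case: nasc.
  by rewrite -ascentE; apply: asc; rewrite mem_enum.
by apply/nbound/H => i _; rewrite ascentE.
Qed.

End StrongOrderFormula.

(** The points of the chain are those of the pseudometric [layered_dist], which
    embeds in [U] as [nat * nat] is countable. *)
Lemma SOP_of_not_arch_at (d : Order.disp_t) (R : distanceMonoidType d) (U : metricSpace R) p :
  urysohnSpace U -> (0 < p)%N -> ~ arch_at R p -> SOP p.+1 (Th (metric_structure U)).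
Proof.
move=> U_urysohn p_gt0 /existsNP[r /not_implyP[r_mono r_neq]].
(* The maximum extends the bound [r0 <= rho t] to all [t]; it equals [r t.+1] for
   the [p] steps in use. *)
pose r0 := r 0%N; pose rho t := Order.max r0 (r t.+1).
have r0_le t : r0 <= rho t by rewrite le_max lexx.
have gapE : layer_gap rho 0 p = \big[dm_add/0]_(1 <= i < p.+1) r i.
  rewrite big_add1 /=; apply: eq_big_nat => t /andP[_ tp].
  apply: max_r; elim: t tp => [|t IHt] tp; first exact: r_mono.
  exact: le_trans (IHt (ltnW tp)) (r_mono _ tp).
have gap_lt : layer_gap rho 0 p < layer_gap rho 0 p ⊕ r0.
  rewrite lt_neqAle dm_leDr andbT gapE; apply/eqP => gap_eq; apply: r_neq.
  by rewrite big_ltn // dm_addC -/r0 -gap_eq.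
pose at_nat k : nat * nat := odflt (0%N, 0%N) (unpickle k).
have [|u u_iso] := sequence_pseudometric_embedding U_urysohn
    (D := fun k l => layered_dist r0 rho (at_nat k) (at_nat l)).
  have [D0 Dsym Dtri] := layered_pseudometric r0_le.
  by split=> [k|k l|k l m]; [apply: D0|apply: Dsym|apply: Dtri].
pose point (k i : nat) : U := u (pickle (k, i)).
have pointE k i l j : dist (point k i) (point l j) = layered_dist r0 rho (k, i) (l, j).
  by rewrite u_iso /at_nat !pickleK.
exists p.+1, (climb rho p); split.
  exists (metric_structure U), (fun k => [tuple point k i | i < p.+1]); split=> // k l kl.
  apply/sat_climb; split=> [i|].
    rewrite !tnth_mktuple le_distE pointE layered_distE //= /penalty kl dm_addr0.
    by rewrite /layer_gap big_nat1.
  rewrite !tnth_mktuple le_distE pointE.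
  rewrite layered_distE //= /penalty ltnNge (ltnW kl) /=.
  by apply/negP; rewrite -ltNge.
move=> [M [x [M_models x_climb]]].
(* Each arrow of the cycle is used to climb one layer. *)
have climb_to k (kp : (k < p.+1)%N) :
    le_dist (layer_gap rho 0 k) (tnth (x ord0) ord0) (tnth (x (Ordinal kp)) (Ordinal kp)).
  elim: k kp => [|k IHk] kp.
    rewrite /layer_gap big_geq //; apply/(le_dist0 M_models).
    by rewrite (_ : Ordinal kp = ord0) //; apply: val_inj.
  have kp' : (k < p)%N by [].
  have /sat_climb[/(_ (Ordinal kp')) step _] := x_climb (Ordinal (ltnW kp)).
  rewrite (layer_gap_cat rho (leq0n k) (leqnSn k)) {2}/layer_gap big_nat1.
  apply: (le_dist_triangle M_models (IHk (ltnW kp))).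
  have ordS_k : ordS (Ordinal (ltnW kp)) = Ordinal kp.
    by apply: val_inj; rewrite /= modn_small.
  move: step; rewrite ordS_k.
  rewrite (_ : widen_ord _ _ = Ordinal (ltnW kp)); last exact: val_inj.
  by rewrite (_ : lift ord0 _ = Ordinal kp) //; apply: val_inj.
have /sat_climb[_] := x_climb ord_max; apply.
rewrite (_ : ordS ord_max = ord0); last by apply: val_inj; rewrite /= modnn.
by move: (climb_to p (ltnSn p)); rewrite (_ : Ordinal _ = ord_max) //; apply: val_inj.
Qed.

(** * From a chain to a cycle *)

(** For the numbers [u] and [v] of arrows that a path of the cycle follows forwards
    and backwards, this is the dichotomy between paths that do not wind and paths
    with many arrows. *)
Lemma eqmod_far n u v : u = v %[mod n] -> u = v \/ (n <= u + v)%N.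
Proof.
wlog uv : u v / (u <= v)%N => [wlog_uv|].
  case: (leqP u v) => [|/ltnW] /wlog_uv H /esym; last by move=> /H[->|]; [left|rewrite addnC; right].
  by move=> /esym/H.
move=> /esym/eqP; rewrite eqn_mod_dvd // => dvd_n.
case: (ltngtP u v) uv => // [ltuv _|-> _]; last by left.
right; apply: leq_trans (dvdn_leq _ dvd_n) _; first by rewrite subn_gt0.
by rewrite (leq_trans (leq_subr _ _)) ?leq_addl.
Qed.

Lemma seq_minimum (d : Order.disp_t) (T : orderType d) (s : seq T) :
  (0 < size s)%N -> exists2 x, x \in s & {in s, forall y, x <= y}.
Proof.
case: s => // x s _; elim: s => [|y s [z zs z_min]].
  by exists x => [|y]; rewrite inE // => /eqP->.
case: (leP z y) => [zy|yz].
  exists z => [|t]; first by move: zs; rewrite !inE => /orP[->//|->]; rewrite !orbT.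
  rewrite !inE => /or3P[/eqP->|/eqP->//|ts]; apply: z_min; rewrite inE ?eqxx ?ts ?orbT //.
exists y => [|t]; first by rewrite !inE eqxx orbT.
rewrite !inE => /or3P[/eqP->|/eqP->//|ts]; apply: le_trans (ltW yz) (z_min _ _).
  by rewrite mem_head.
by rewrite inE ts orbT.
Qed.

(** ** Walks along a chain *)

Section Walks.
Variables (d : Order.disp_t) (R : distanceMonoidType d) (U : metricSpace R).
Variable M : structure (metric_language R).
Hypothesis M_models : models M (Th (metric_structure U)).
Variables (m : nat) (a : nat -> m.-tuple M).

Definition level_edge (i j : 'I_m) (r : R) : Prop :=
  forall k, le_dist r (tnth (a k) i) (tnth (a k) j).

Definition shift_edge (i j : 'I_m) (r : R) : Prop :=
  forall k l, (k < l)%N -> le_dist r (tnth (a k) i) (tnth (a l) j).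

(** A walk records the positions within tuples, but not the tuples themselves, so
    that it can be started anywhere, in the cycle and in the chain.  In
    [walk i j u v s r], there are [u] moves to a later and [v] moves to an earlier
    tuple, [s] lists the costs of these moves, and [r] is the total cost, which
    includes the moves inside a tuple. *)
Inductive walk : 'I_m -> 'I_m -> nat -> nat -> seq R -> R -> Prop :=
| WalkNil i : walk i i 0 0 [::] 0
| WalkLevel i j h u v s r r' : level_edge i j r -> walk j h u v s r' ->
    walk i h u v s (r ⊕ r')
| WalkUp i j h u v s r r' : shift_edge i j r -> walk j h u v s r' ->
    walk i h u.+1 v (r :: s) (r ⊕ r')
| WalkDown i j h u v s r r' : shift_edge j i r -> walk j h u v s r' ->
    walk i h u v.+1 (r :: s) (r ⊕ r').

Lemma walk_cat i j h u v s r u' v' s' r' :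
  walk i j u v s r -> walk j h u' v' s' r' ->
  walk i h (u + u') (v + v') (s ++ s') (r ⊕ r').
Proof.
move=> W W'; elim: W h W' => {i j u v s r} [i|i j h u v s r0 r E _ IH|
  i j h u v s r0 r E _ IH|i j h u v s r0 r E _ IH] t W'.
- by rewrite dm_add0.
- by rewrite -dm_addA; apply: WalkLevel E (IH _ W').
- by rewrite -dm_addA addSn; apply: WalkUp E (IH _ W').
- by rewrite -dm_addA addSn; apply: WalkDown E (IH _ W').
Qed.

Lemma size_walk i j u v s r : walk i j u v s r -> size s = (u + v)%N.
Proof. by elim=> //= *; lia. Qed.

Lemma walk_total i j u v s r : walk i j u v s r ->
  exists t, r = \big[dm_add/0]_(x <- s) x ⊕ t.
Proof.
elim=> [_|_ _ _ _ _ {}s r0 {}r _ _ [t ->]|_ _ _ _ _ {}s r0 {}r _ _ [t ->]|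
  _ _ _ _ _ {}s r0 {}r _ _ [t ->]].
- by exists 0; rewrite big_nil dm_add0.
- by exists (r0 ⊕ t); rewrite !dm_addA [r0 ⊕ _]dm_addC.
- by exists t; rewrite big_cons dm_addA.
- by exists t; rewrite big_cons dm_addA.
Qed.

(** The lift moves to the next or the previous tuple of the chain; the bound on
    [k] keeps it within the natural numbers. *)
Lemma walk_lift i j u v s r : walk i j u v s r ->
  forall k l, (v <= k)%N -> (k + u = l + v)%N ->
  le_dist r (tnth (a k) i) (tnth (a l) j).
Proof.
elim=> {i j u v s r} [i|i j h u v s r0 r E _ IH|i j h u v s r0 r E _ IH|
  i j h u v s r0 r E _ IH] k l vk kl.
- have -> : k = l by lia.
  exact/(le_dist0 M_models).
- exact: (le_dist_triangle M_models (E k) (IH _ _ vk kl)).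
- apply: (le_dist_triangle M_models (E k k.+1 (ltnSn k)) (IH _ _ _ _)); lia.
- have lt_k : (k.-1 < k)%N by lia.
  apply: (le_dist_triangle M_models (le_dist_sym M_models (E _ _ lt_k)) (IH _ _ _ _)); lia.
Qed.

(** In the chain, a shift edge joins a tuple to every later one.  Following the
    edge of cost [f] back and forth once more, one can thus pass to any other
    tuple, and so connect any [k] to any [l]. *)
Lemma walk_lift_zigzag i j u v s r f : walk i j u v s r -> f \in s ->
  forall k l, (size s <= k)%N -> (size s <= l)%N ->
  le_dist (f ⊕ f ⊕ r) (tnth (a k) i) (tnth (a l) j).
Proof.
have tri := le_dist_triangle M_models; have sym := le_dist_sym M_models.
have swap r0 r' : f ⊕ f ⊕ (r0 ⊕ r') = r0 ⊕ (f ⊕ f ⊕ r').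
  by rewrite !dm_addA [f ⊕ f ⊕ r0]dm_addC dm_addA.
elim=> {i j u v s r} [i|i j h u v s r0 r E _ IH|i j h u v s r0 r E W IH|
  i j h u v s r0 r E W IH] // fs k l /= sk sl.
- by rewrite swap; apply: (tri _ _ _ _ _ (E k)); apply: IH.
- case/predU1P: fs => [->|fs]; last first.
    rewrite swap; apply: (tri _ _ _ _ _ (E k k.+1 (ltnSn k))); apply: IH => //; lia.
  have sz := size_walk W; set q := (l + v - u)%N.
  (* The rest of the walk leads from [q] to [l]; the extra moves make the walk
     enter it at [q], along k -> (k + q).+1 -> q.-1 -> q. *)
  have lt_k : (k < (k + q).+1)%N by lia.
  rewrite -!dm_addA; apply: (tri _ _ _ _ _ (E _ _ lt_k)).
  have lt_q : (q.-1 < (k + q).+1)%N by lia.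
  apply: (tri _ _ _ _ _ (sym _ _ _ (E _ _ lt_q))).
  have lt_q' : (q.-1 < q)%N by lia.
  apply: (tri _ _ _ _ _ (E _ _ lt_q')).
  by apply: (walk_lift W); lia.
- case/predU1P: fs => [->|fs]; last first.
    have lt_k : (k.-1 < k)%N by lia.
    rewrite swap; apply: (tri _ _ _ _ _ (sym _ _ _ (E _ _ lt_k))); apply: IH => //; lia.
  have sz := size_walk W; set q := (l + v - u)%N.
  (* Here the extra moves are k -> 0 -> q.+1 -> q. *)
  have lt_k : (0 < k)%N by lia.
  rewrite -!dm_addA; apply: (tri _ _ _ _ _ (sym _ _ _ (E _ _ lt_k))).
  apply: (tri _ _ _ _ _ (E _ _ (ltn0Sn q))).
  apply: (tri _ _ _ _ _ (sym _ _ _ (E _ _ (ltnSn q)))).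
  by apply: (walk_lift W); lia.
Qed.

(** The two extra copies of the cheapest arrow do not change the total cost. *)
Lemma walk_long N i j u v s r : arch_at R N -> (0 < N <= u + v)%N -> walk i j u v s r ->
  forall k l, (u + v <= k)%N -> (u + v <= l)%N ->
  le_dist r (tnth (a k) i) (tnth (a l) j).
Proof.
move=> archN /andP[N_gt0 N_le] W k l; rewrite -(size_walk W) in N_le * => sk sl.
have [f fs f_min] := seq_minimum (leq_trans N_gt0 N_le).
have := walk_lift_zigzag W fs sk sl; have [t ->] := walk_total W.
by rewrite [X in le_dist X _ _]dm_addA -[f ⊕ f ⊕ _]dm_addA !(absorb_min archN N_le f_min).
Qed.

(** ** Closing up a homogeneous chain *)

Section Cycle.
Hypothesis U_urysohn : urysohnSpace U.
Variables (n : nat) (F : seq R).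
Hypotheses (n_ge3 : (3 <= n)%N) (arch_n : arch_at R n.-1) (F0 : dm_zero \in F).
Hypothesis a_homogeneous : forall i j r, r \in F ->
  (level_edge i j r \/ forall k, ~ le_dist r (tnth (a k) i) (tnth (a k) j)) /\
  (shift_edge i j r \/
    forall k l, (k < l)%N -> ~ le_dist r (tnth (a k) i) (tnth (a l) j)).

Definition cycle_edge (z z' : 'I_n * 'I_m) (r : R) : Prop :=
  [\/ z.1 = z'.1 /\ level_edge z.2 z'.2 r,
      z'.1 = ordS z.1 /\ shift_edge z.2 z'.2 r |
      z.1 = ordS z'.1 /\ shift_edge z'.2 z.2 r].

(** The value [C] is the weight of the pairs without a prescribed radius.  It is
    chosen in [large_distance] so that a path through such a pair violates no
    lower bound. *)
Definition cycle_weight (C : R) (z z' : 'I_n * 'I_m) : R :=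
  \big[Order.min/C]_(r <- F | `[< cycle_edge z z' r >]) r.

Lemma cycle_weight_le C z z' r : r \in F -> cycle_edge z z' r -> cycle_weight C z z' <= r.
Proof. move=> rF E; apply: bigmin_inf_seq rF _ (lexx r); exact/asboolP. Qed.

Lemma cycle_weightP C z z' :
  cycle_weight C z z' = C \/ cycle_edge z z' (cycle_weight C z z').
Proof.
apply: (big_ind (fun r => r = C \/ cycle_edge z z' r)).
- by left.
- by move=> r r' ? ?; rewrite /Order.min; case: ifP.
- by move=> r /asboolP; right.
Qed.

Lemma cycle_edge_sym z z' r : cycle_edge z z' r -> cycle_edge z' z r.
Proof.
case=> [[zz' E]|[zz' E]|[zz' E]].
- by constructor 1; split=> // k; apply: (le_dist_sym M_models).
- by constructor 3.
- by constructor 2.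
Qed.

Lemma cycle_weight_sym C z z' : cycle_weight C z z' = cycle_weight C z' z.
Proof.
by apply: eq_bigl => r; apply/asboolP/asboolP; apply: cycle_edge_sym.
Qed.

Lemma cycle_weight_refl C z : cycle_weight C z z = 0.
Proof.
apply/dm_le0_eq/cycle_weight_le => //; constructor 1; split=> // k.
exact/(le_dist0 M_models).
Qed.

(** The invariant of path costs for [floyd_warshall_ind].  The congruence says
    that the walk leads from the tuple of [z] to that of [z'] around [Z/n]. *)
Definition cycle_walk (C : R) (z z' : 'I_n * 'I_m) (r : R) : Prop :=
  C <= r \/ exists u v s, walk z.2 z'.2 u v s r /\ (z.1 + u = z'.1 + v %[mod n])%N.

Lemma cycle_walk_cat C z z' z'' r r' :
  cycle_walk C z z' r -> cycle_walk C z' z'' r' -> cycle_walk C z z'' (r ⊕ r').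
Proof.
case=> [Cr _|[u [v [s [W E]]]]]; first by left; apply: le_trans Cr (dm_leDr _ _).
case=> [Cr|[u' [v' [s' [W' E']]]]]; first by left; apply: le_trans Cr (dm_leDl _ _).
right; exists (u + u')%N, (v + v')%N, (s ++ s'); split; first exact: walk_cat W'.
by rewrite addnA -modnDml E modnDml addnAC -modnDml E' modnDml addnAC addnA.
Qed.

Lemma cycle_walk_weight C z z' : cycle_walk C z z' (cycle_weight C z z').
Proof.
have [->|] := cycle_weightP C z z'; first by left.
move: (cycle_weight _ _ _) => r E; right; rewrite -(dm_addr0 r).
case: E => [[zz' E]|[zz' E]|[zz' E]].
- exists 0%N, 0%N, [::]; rewrite zz'; split=> //.
  by apply: WalkLevel E (WalkNil _).
- exists 1%N, 0%N, [:: r]; split; first exact: WalkUp E (WalkNil _).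
  by rewrite zz' /= addn0 modn_mod addn1.
- exists 0%N, 1%N, [:: r]; split; first exact: WalkDown E (WalkNil _).
  by rewrite zz' /= addn0 modn_mod addn1.
Qed.

(** A cheap path of the cycle between two points of one tuple, or of consecutive
    tuples, bounds the corresponding distances in the chain: if it winds, then
    [n.-1 <= u + v]. *)
Lemma cycle_walk_level C k i j r : cycle_walk C (k, i) (k, j) r ->
  C <= r \/ exists K, le_dist r (tnth (a K) i) (tnth (a K) j).
Proof.
case=> [|[u [v [s [/= W /eqP]]]]]; first by left.
rewrite eqn_modDl => /eqP/eqmod_far[uv|uv]; right; exists (u + v)%N.
  by apply: (walk_lift W); lia.
by apply: (walk_long arch_n _ W); lia.
Qed.

Lemma cycle_walk_shift C k i j r : cycle_walk C (k, i) (ordS k, j) r ->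
  C <= r \/ exists K L, (K < L)%N /\ le_dist r (tnth (a K) i) (tnth (a L) j).
Proof.
case=> [|[u [v [s [/= W]]]]]; first by left.
rewrite modnDml addSnnS => /eqP; rewrite eqn_modDl => /eqP/eqmod_far[uv|uv];
  right; exists (u + v)%N, (u + v).+1; split=> //.
  by apply: (walk_lift W); lia.
by apply: (walk_long arch_n _ W); lia.
Qed.

(** A radius of [F] that is not a bound for all distances is exceeded by some
    distance in [U], and [C] is at least as large as one such distance for each
    of these radii. *)
Lemma large_distance : exists C : R, forall r, r \in F -> C <= r ->
  forall x y : M, le_dist r x y.
Proof.
elim: F => [|r s [C CP]]; first by exists 0.
have [r_bound|] := pselect (forall x y : U, dist x y <= r).
  exists C => r'; rewrite inE => /predU1P[-> _|]; last exact: CP.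
  exact: (le_dist_bounded M_models).
move=> /existsNP[x /existsNP[y /negP]]; rewrite -ltNge => r_lt.
exists (Order.max C (dist x y)) => r'; rewrite inE ge_max => /predU1P[->|r's] /andP[Cr xyr].
  by move: r_lt; rewrite ltNge xyr.
exact: CP.
Qed.

(** Upper bounds hold by the choice of the weights.  If a distance in the cycle is
    at most [r], then so is one of the corresponding distances in the chain, hence
    by homogeneity all of them. *)
Lemma closed_chain_realized : exists x : 'I_n -> m.-tuple U,
  forall r, r \in F -> forall k i j,
    (dist (tnth (x k) i) (tnth (x k) j) <= r <-> level_edge i j r) /\
    (dist (tnth (x k) i) (tnth (x (ordS k)) j) <= r <-> shift_edge i j r).
Proof.
have [C CP] := large_distance.
pose D := floyd_warshall (cycle_weight C) (enum {: 'I_n * 'I_m}).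
have [|f f_iso] := finite_pseudometric_embedding U_urysohn (D := D).
  exact: floyd_warshall_pseudometric (cycle_weight_sym C) (cycle_weight_refl C).
have D_walk z z' : cycle_walk C z z' (D z z').
  apply: floyd_warshall_ind => [*|]; first exact: cycle_walk_weight.
  exact: cycle_walk_cat.
have D_edge z z' r : r \in F -> cycle_edge z z' r -> D z z' <= r.
  by move=> rF E; apply: le_trans (floyd_warshall_le _ _ _ _) (cycle_weight_le C rF E).
exists (fun k => [tuple f (k, i) | i < m]) => r rF k i j.
rewrite !tnth_mktuple !f_iso; have [lvl shf] := a_homogeneous i j rF.
split; split=> [Dr|E].
- case: lvl => // nlvl; have [CD|[K DK]] := cycle_walk_level (D_walk (k, i) (k, j)).
    by case: (nlvl 0%N); apply: CP => //; apply: le_trans Dr.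
  by case: (nlvl K); apply: (le_dist_mono M_models Dr).
- by apply: D_edge => //; constructor 1.
- case: shf => // nshf.
  have [CD|[K [L [KL DK]]]] := cycle_walk_shift (D_walk (k, i) (ordS k, j)).
    by case: (nshf 0%N 1%N) => //; apply: CP => //; apply: le_trans Dr.
  by case: (nshf K L) => //; apply: (le_dist_mono M_models Dr).
- by apply: D_edge => //; constructor 2.
Qed.

End Cycle.
End Walks.

(** Colour the pairs of the chain by the comparisons that the quantifier-free form
    of the formula depends on, and close up a homogeneous subchain.  The radius
    [0] is included because it decides equality. *)
Lemma not_arch_at_of_SOP (d : Order.disp_t) (R : distanceMonoidType d) (U : metricSpace R) n :
  urysohnSpace U -> quantifier_elimination (Th (metric_structure U)) -> (3 <= n)%N ->
  SOP n (Th (metric_structure U)) -> ~ arch_at R n.-1.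
Proof.
move=> U_urysohn QE n_ge3 [m [p [[M [a [M_models a_chain]]] no_cycle]]] arch_n.
have [q q_free pq] := QE _ p.
have U_models : models (metric_structure U) (Th (metric_structure U)) by [].
pose F := dm_zero :: radii q.
(* The boolean distinguishes comparisons inside a tuple, which depend on [k] only,
   from comparisons between two tuples. *)
pose color (c : ('I_m * 'I_m * R) * bool) k l :=
  let: ((i, j, r), b) := c in
  le_dist r (tnth (a k) i) (tnth (a (if b then k else l)) j).
pose colors := [seq (c, b) |
  c <- [seq (z, r) | z <- enum {: 'I_m * 'I_m}, r <- F], b <- [:: true; false]].
have in_colors i j r b : r \in F -> ((i, j), r, b) \in colors.
  move=> rF; apply: allpairs_f; last by case: b.
  by apply: allpairs_f => //; rewrite mem_enum.
have [g g_inc g_color] := ramsey_pairs_family colors color.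
pose b k := a (g k).
have b_hom i j r : r \in F ->
    (level_edge b i j r \/ forall k, ~ le_dist r (tnth (b k) i) (tnth (b k) j)) /\
    (shift_edge b i j r \/
      forall k l, (k < l)%N -> ~ le_dist r (tnth (b k) i) (tnth (b l) j)).
  move=> rF; split; last exact: (g_color _ (in_colors i j r false rF)).
  have [H|H] := g_color _ (in_colors i j r true rF); [left|right] => k;
    exact: (H k k.+1).
have [x xP] := closed_chain_realized M_models U_urysohn n_ge3 arch_n (mem_head _ _) b_hom.
have level_iff r i j k l : r \in F ->
    dist (tnth (x k) i) (tnth (x k) j) <= r <->
    le_dist r (tnth (b l) i) (tnth (b l) j).
  move=> rF; rewrite (proj1 (xP r rF k i j)); split=> [|bl]; first exact.
  by have [[//|/(_ l)]] := b_hom i j r rF.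
have shift_iff r i j k : r \in F ->
    dist (tnth (x k) i) (tnth (x (ordS k)) j) <= r <->
    le_dist r (tnth (b 0%N) i) (tnth (b 1%N) j).
  move=> rF; rewrite (proj2 (xP r rF k i j)); split=> [|bl]; first exact.
  by have [_ [//|/(_ 0%N 1%N isT)]] := b_hom i j r rF.
apply: no_cycle; exists (metric_structure U), x; split=> // k.
set e' := cat_tuple _ _; pose e := cat_tuple (b 0%N) (b 1%N).
have same_type r : r \in F -> forall i j,
    le_dist r (tnth e i) (tnth e j) <-> le_dist r (tnth e' i) (tnth e' j).
  move=> rF i j; rewrite le_distE.
  case: (split_ordP i) => {}i ->; case: (split_ordP j) => {}j ->;
    rewrite /e /e' ?tnth_lshift ?tnth_rshift.
  - by apply: iff_sym; apply: level_iff.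
  - by apply: iff_sym; apply: shift_iff.
  - by rewrite dist_sym shift_iff //; split; apply: (le_dist_sym M_models).
  - by apply: iff_sym; apply: level_iff.
have q_iff : sat q e <-> sat q e'.
  apply: sat_quantifier_free => // [i j|r i j rq]; last first.
    by apply: same_type; rewrite inE rq orbT.
  apply: iff_trans (iff_sym (le_dist0 M_models _ _)) _.
  by apply: iff_trans (le_dist0 U_models _ _); apply: same_type; apply: mem_head.
by apply/(pq _ U_models)/q_iff/pq => //; apply/a_chain/g_inc.
Qed.

Theorem theorem3 (d : Order.disp_t) (R : distanceMonoidType d)
    (U : metricSpace R) (n : nat)
    (R_countable : countable [set: R])
    (U_urysohn : urysohnSpace U)
    (Th_QE : quantifier_elimination (Th (metric_structure U)))
    (n_ge3 : (3 <= n)%N) :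
  SOP n (Th (metric_structure U)) <-> le_omega n (arch R).
Proof.
case: n n_ge3 => // p n_ge3; rewrite le_omega_arch; split.
  exact: not_arch_at_of_SOP.
by apply: SOP_of_not_arch_at => //; lia.
Qed.
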